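(* Let $A=A^T\in\mathbb R^{n\times n}$ and let $k\ge1$. Choose positive block sizes $r_1,\ldots,r_k$ and put $m=\sum_{i=1}^kr_i$. For $1\le i\le k$, let $E_i\in\mathbb R^{m\times r_i}$ be the canonical injection into block $i$. Let $T=T^T\in\mathbb R^{m\times m}$ be block tridiagonal with respect to this partition. Let $0\le s\le r_k$ and suppose $V=[V_1\ \cdots\ V_k]\in\mathbb R^{n\times m}$ (with $V_i\in\mathbb R^{n\times r_i}$), $W\in\mathbb R^{n\times s}$, $H\in\mathbb R^{s\times r_k}$, and $F\in\mathbb R^{n\times m}$ satisfy $V_i^TV_i=I_{r_i}$ for all $i$, $W^TW=I_s$, and $$AV=VT+WHE_k^T+F .$$ Let $U$ be the strictly block upper triangular matrix with blocks $U_{ij}=V_i^TV_j$ for $i<j$, so that $V^TV=I+U+U^T$, and put $a=V^TW$ and $$M=TU-UT-aHE_k^T .$$ Set $e=\|F\|_2$, $\zeta=\max_{1\le i\le k}\|M_{ii}\|_2$ (where $M_{ii}$ is the $i$th diagonal block of $M$), and $\mu=k\max\{2e,\zeta\}$. Then there are matrices $\widehat V\in\mathbb R^{nk\times m}$, $\widehat W\in\mathbb R^{nk\times s}$, and $\Delta=\Delta^T\in\mathbb R^{nk\times nk}$ such that $$\widehat V^T\widehat V=I_m,\qquad \widehat V^T\widehat W=0,\qquad \|\widehat W\|_2\le1,$$ and $$(I_k\otimes A+\Delta)\widehat V=\widehat VT+\widehat WHE_k^T .$$ The first block satisfies $\widehat VE_1=\operatorname{col}(V_1,0,\ldots,0)$,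 and $$\|\Delta\|_2\le2\left(2\sqrt k\,e+4\sqrt k(\sqrt k+k-1)\mu\right).$$
   Context: $\|\cdot\|_2$ is the spectral norm. $I_k\otimes A$ is the block diagonal matrix with $k$ copies of $A$. $\operatorname{col}(X_1,\ldots,X_j)$ denotes vertical concatenation. When $s=0$ the usual empty-matrix convention is used (products with inner dimension zero are zero matrices). *)

(* Defs.v *)
From mathcomp Require Import all_boot all_order all_algebra.
From mathcomp Require Import boolp classical_sets reals.

Set Implicit Arguments.
Unset Strict Implicit.
Unset Printing Implicit Defensive.

Import Order.TTheory GRing.Theory Num.Theory.
Local Open Scope ring_scope.

Definition l2norm (R : realType) (n : nat) (x : 'cV[R]_n) : R :=
  Num.sqrt (\sum_i x i 0 ^+ 2).

(* The supremum runs over the closed unit ball rather than the unit sphere, so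
   that the set is nonempty, and the norm is 0, also for a matrix without
   columns. *)
Definition specnorm (R : realType) (m n : nat) (A : 'M[R]_(m, n)) : R :=
  sup [set l2norm (A *m x) | x in [set x : 'cV[R]_n | l2norm x <= 1]]%classic.

(* The i-th block column of the identity matrix. *)
Definition blkinj (R : realType) (k : nat) (r : 'I_k -> nat) (i : 'I_k) :
    'M[R]_(\sum_j r j, r i) :=
  submxrow 1%:M i.

Definition block_tridiagonal (R : realType) (k : nat) (r : 'I_k -> nat)
    (T : 'M[R]_(\sum_i r i)) : Prop :=
  forall i j : 'I_k, (i.+1 < j)%N || (j.+1 < i)%N -> submxblock T i j = 0.

Definition strict_upper_gram (R : realType) (n k : nat) (r : 'I_k -> nat)
    (V : 'M[R]_(n, \sum_i r i)) : 'M[R]_(\sum_i r i) :=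
  \mxblock_(i < k, j < k)
    (if (i < j)%N then (submxrow V i)^T *m submxrow V j else 0).

(* Main.v *)
(* Let [B = (1 + U)^-1] and [S = 1 - B = U B], which is strictly block upper
   triangular. From [V^T V = 1 + U + U^T] one gets
   [(V B)^T (V B) = 1 - S^T S], so the blocks [X_l = V B S^l] satisfy
   [X_l^T X_l = (S^l)^T S^l - (S^(l+1))^T S^(l+1)]; since [S^k = 0] the sum over
   [l < k] telescopes to [1], and stacking the [X_l] gives orthonormal columns.
   Enlarging [V] by [W] replaces [U] by the matrix [[U, a], [0, 0]], and the same
   construction dictates the blocks of the next basis vectors:
   [Y_0 = W - V B a] and [Y_(l+1) = X_l B a].
   Because [S T - T S] equals [- B (M + a H E_k^T) B], the residual
   [G_l = A X_l - X_l T - Y_l H E_k^T] obeys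
   [G_0 = F B - V B M B] and [G_(l+1) = G_l S + X_l B M B], hence grows at most
   linearly in [l]. Finally [M] is block upper triangular with
   [M - M^T = V^T F - F^T V], which bounds its blocks above the diagonal by
   [2 e], and the stacked residual [G] is absorbed by the symmetric matrix
   [- G Q^T - Q G^T + Q (G^T Q) Q^T], where [Q] is the stack of the [X_l]. *)
Require Import Defs.
From mathcomp Require Import all_boot all_order all_algebra.
From mathcomp Require Import boolp classical_sets reals.
From mathcomp Require Import ring lra zify.

Set Implicit Arguments.
Unset Strict Implicit.
Unset Printing Implicit Defensive.

Import Order.TTheory GRing.Theory Num.Theory.
Local Open Scope ring_scope.

(** * Inner product, Euclidean norm and spectral norm *)

Definition dotv (R : realType) n (x y : 'cV[R]_n) : R := (x^T *m y) 0 0.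

Section Norms.
Variable R : realType.
Implicit Types m n p : nat.

Lemma dotvC n (x y : 'cV[R]_n) : dotv x y = dotv y x.
Proof. by rewrite /dotv -[x in RHS]trmxK -trmx_mul [RHS]mxE. Qed.

Lemma dotvDr n (x y z : 'cV[R]_n) : dotv x (y + z) = dotv x y + dotv x z.
Proof. by rewrite /dotv mulmxDr mxE. Qed.

Lemma dotvZr n c (x y : 'cV[R]_n) : dotv x (c *: y) = c * dotv x y.
Proof. by rewrite /dotv -scalemxAr mxE. Qed.

Lemma dotv_mulmx m n (A : 'M[R]_(m, n)) x y :
  dotv (A *m x) y = dotv x (A^T *m y).
Proof. by rewrite /dotv trmx_mul mulmxA. Qed.

Lemma dotvv n (x : 'cV[R]_n) : dotv x x = \sum_i x i 0 ^+ 2.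
Proof. by rewrite /dotv mxE; apply: eq_bigr => i _; rewrite mxE expr2. Qed.

Lemma l2norm_ge0 n (x : 'cV[R]_n) : 0 <= l2norm x.
Proof. exact: sqrtr_ge0. Qed.

Lemma l2norm_sqr n (x : 'cV[R]_n) : l2norm x ^+ 2 = dotv x x.
Proof. by rewrite dotvv sqr_sqrtr// sumr_ge0// => i _; apply: sqr_ge0. Qed.

Lemma l2norm0_eq0 n (x : 'cV[R]_n) : l2norm x = 0 -> x = 0.
Proof.
move=> x0; have /eqP : \sum_i x i 0 ^+ 2 = 0 by rewrite -dotvv -l2norm_sqr x0 expr0n.
rewrite psumr_eq0 => [/allP xi0|i _]; last exact: sqr_ge0.
apply/colP => i; rewrite mxE; apply/eqP; rewrite -sqrf_eq0.
by apply: (implyP (xi0 i _)); rewrite ?mem_index_enum.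
Qed.

Lemma l2norm0 n : l2norm (0 : 'cV[R]_n) = 0.
Proof. by apply/eqP; rewrite -sqrf_eq0 l2norm_sqr /dotv mulmx0 mxE. Qed.

Lemma l2normZ n c (x : 'cV[R]_n) : l2norm (c *: x) = `|c| * l2norm x.
Proof.
apply/eqP; rewrite -(@eqrXn2 _ 2) ?mulr_ge0 ?l2norm_ge0//.
by rewrite exprMn !l2norm_sqr real_normK ?num_real// dotvZr dotvC dotvZr mulrA -expr2.
Qed.

Lemma dotv_le n (x y : 'cV[R]_n) : dotv x y <= l2norm x * l2norm y.
Proof.
have [x0|x0] := eqVneq (l2norm x) 0.
  by rewrite x0 mul0r (l2norm0_eq0 x0) /dotv trmx0 mul0mx mxE.
have [y0|y0] := eqVneq (l2norm y) 0.
  by rewrite y0 mulr0 (l2norm0_eq0 y0) /dotv mulmx0 mxE.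
have x_gt0 : 0 < l2norm x by rewrite lt_def x0 l2norm_ge0.
have y_gt0 : 0 < l2norm y by rewrite lt_def y0 l2norm_ge0.
have := sqr_ge0 (l2norm (l2norm y *: x + (- l2norm x) *: y)).
rewrite l2norm_sqr dotvDr !(dotvZr, dotvC (_ + _)) !dotvDr !dotvZr -!l2norm_sqr.
(* The square of the norm of [|y| x - |x| y] expands to [2 |x| |y| (|x| |y| - x . y)]; dividing by
   the positive factor gives the claim. *)
rewrite (dotvC y x) => H; rewrite -subr_ge0 -(pmulr_rge0 _ (mulr_gt0 x_gt0 y_gt0)).
by lra.
Qed.

Lemma l2normD n (x y : 'cV[R]_n) : l2norm (x + y) <= l2norm x + l2norm y.
Proof.
rewrite -ler_sqr ?nnegrE ?addr_ge0 ?l2norm_ge0//.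
rewrite l2norm_sqr dotvDr !(dotvC (x + y)) !dotvDr -!l2norm_sqr (dotvC y x).
by have := dotv_le x y; lra.
Qed.

(** Ensures that the supremum in [specnorm] is taken over a bounded set. Cauchy-Schwarz on each row
    gives the Frobenius norm as constant. *)
Lemma l2norm_mulmx_bounded m n (A : 'M[R]_(m, n)) :
  exists c, forall x, l2norm (A *m x) <= c * l2norm x.
Proof.
exists (Num.sqrt (\sum_i l2norm (row i A)^T ^+ 2)) => x.
rewrite -ler_sqr ?nnegrE ?mulr_ge0 ?sqrtr_ge0 ?l2norm_ge0//.
rewrite l2norm_sqr dotvv exprMn [X in X * _]sqr_sqrtr; last first.
  by apply: sumr_ge0 => i _; apply: sqr_ge0.
rewrite mulr_suml; apply: ler_sum => i _.
have -> : (A *m x) i 0 = dotv (row i A)^T x.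
  by rewrite /dotv trmxK -row_mul [RHS]mxE.
rewrite -exprMn -[leLHS]real_normK ?num_real// lerXn2r ?nnegrE//.
  by rewrite mulr_ge0 ?l2norm_ge0.
rewrite ler_norml dotv_le andbT lerNl.
have := dotv_le (row i A)^T (-1 *: x).
by rewrite dotvZr l2normZ mulN1r normrN1 mul1r.
Qed.

Lemma specnorm_le m n (A : 'M[R]_(m, n)) c :
  0 <= c -> (forall x, l2norm (A *m x) <= c * l2norm x) -> specnorm A <= c.
Proof.
move=> c0 Ac; apply: ge_sup => [|_ [x /= x1 <-]].
  by exists (l2norm (A *m 0)), 0 => //=; rewrite l2norm0 ler01.
by apply: le_trans (Ac x) _; rewrite ler_piMr.
Qed.

Lemma specnorm_ub m n (A : 'M[R]_(m, n)) x :
  l2norm x <= 1 -> l2norm (A *m x) <= specnorm A.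
Proof.
move=> x1; apply: ub_le_sup; last by exists x.
have [c Ac] := l2norm_mulmx_bounded A.
exists `|c| => _ [y /= y1 <-]; apply: le_trans (Ac y) _.
by apply: le_trans (ler_norm _) _; rewrite normrM ler_piMr// ger0_norm ?l2norm_ge0.
Qed.

Lemma specnorm_ge0 m n (A : 'M[R]_(m, n)) : 0 <= specnorm A.
Proof.
by rewrite (le_trans (l2norm_ge0 (A *m 0)))// specnorm_ub// l2norm0 ler01.
Qed.

Lemma l2norm_mulmx m n (A : 'M[R]_(m, n)) x :
  l2norm (A *m x) <= specnorm A * l2norm x.
Proof.
have [x0|x0] := eqVneq (l2norm x) 0.
  by rewrite x0 (l2norm0_eq0 x0) mulmx0 l2norm0 mulr0.
have x_gt0 : 0 < l2norm x by rewrite lt_def x0 l2norm_ge0.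
rewrite -ler_pdivrMr// mulrC -[_^-1]ger0_norm ?invr_ge0 ?l2norm_ge0// -l2normZ.
rewrite scalemxAr specnorm_ub// l2normZ ger0_norm ?invr_ge0 ?l2norm_ge0//.
by rewrite mulVf.
Qed.

Lemma specnorm0 m n : specnorm (0 : 'M[R]_(m, n)) = 0.
Proof.
apply/le_anti; rewrite specnorm_ge0 andbT; apply: specnorm_le => // x.
by rewrite mul0mx l2norm0 mul0r.
Qed.

Lemma specnormN m n (A : 'M[R]_(m, n)) : specnorm (- A) = specnorm A.
Proof.
suff le (B : 'M[R]_(m, n)) : specnorm (- B) <= specnorm B.
  by apply/le_anti; rewrite le -{1}[A]opprK le.
apply: specnorm_le (specnorm_ge0 B) _ => x.
by rewrite mulNmx -scaleN1r l2normZ normrN1 mul1r l2norm_mulmx.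
Qed.

Lemma specnormD m n (A B : 'M[R]_(m, n)) :
  specnorm (A + B) <= specnorm A + specnorm B.
Proof.
apply: specnorm_le => [|x]; first by rewrite addr_ge0 ?specnorm_ge0.
by rewrite mulmxDl mulrDl (le_trans (l2normD _ _))// lerD ?l2norm_mulmx.
Qed.

Lemma specnormB m n (A B : 'M[R]_(m, n)) :
  specnorm (A - B) <= specnorm A + specnorm B.
Proof. by rewrite -(specnormN B) specnormD. Qed.

Lemma specnormM m n p (A : 'M[R]_(m, n)) (B : 'M[R]_(n, p)) :
  specnorm (A *m B) <= specnorm A * specnorm B.
Proof.
apply: specnorm_le => [|x]; first by rewrite mulr_ge0 ?specnorm_ge0.
rewrite -mulmxA (le_trans (l2norm_mulmx _ _))// -mulrA ler_wpM2l ?specnorm_ge0//.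
exact: l2norm_mulmx.
Qed.

Lemma specnormM_le m n p (A : 'M[R]_(m, n)) (B : 'M[R]_(n, p)) a b :
  specnorm A <= a -> specnorm B <= b -> specnorm (A *m B) <= a * b.
Proof.
move=> Aa Bb; apply: le_trans (specnormM A B) _.
by rewrite ler_pM ?specnorm_ge0.
Qed.

(** With [z = B^T x], the square [|z|^2 = x . (B z)] is at most [|x|] times [specnorm B] times
    [|z|], and one factor [|z|] cancels. *)
Lemma specnorm_tr m n (A : 'M[R]_(m, n)) : specnorm A^T = specnorm A.
Proof.
suff le p q (B : 'M[R]_(p, q)) : specnorm B^T <= specnorm B.
  by apply/le_anti; rewrite le -{1}[A]trmxK le.
apply: specnorm_le (specnorm_ge0 B) _ => x.
have [/eqP z0|z0] := boolP (l2norm (B^T *m x) == 0).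
  by rewrite z0 mulr_ge0 ?specnorm_ge0 ?l2norm_ge0.
have z_gt0 : 0 < l2norm (B^T *m x) by rewrite lt_def z0 l2norm_ge0.
rewrite -(ler_pM2l z_gt0) -expr2 l2norm_sqr dotv_mulmx trmxK.
apply: le_trans (dotv_le _ _) _; rewrite [leLHS]mulrC mulrA ler_wpM2r ?l2norm_ge0//.
by rewrite mulrC l2norm_mulmx.
Qed.

(** Stacking [A] over [Z] gives an isometry, so [|A x|^2 + |Z x|^2 = |x|^2]. All later bounds by 1
    come from exhibiting a suitable complement [Z]. *)
Lemma specnorm_gram_le1 m n p (A : 'M[R]_(m, n)) (Z : 'M[R]_(p, n)) :
  A^T *m A + Z^T *m Z = 1%:M -> specnorm A <= 1.
Proof.
move=> AZ; apply: specnorm_le ler01 _ => x.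
rewrite mul1r -ler_sqr ?nnegrE ?l2norm_ge0//.
have -> : l2norm x ^+ 2 = l2norm (A *m x) ^+ 2 + l2norm (Z *m x) ^+ 2.
  by rewrite !l2norm_sqr !dotv_mulmx -dotvDr !mulmxA -mulmxDl AZ mul1mx.
by rewrite lerDl sqr_ge0.
Qed.

Lemma specnorm_isometry_le1 m n (Q : 'M[R]_(m, n)) :
  Q^T *m Q = 1%:M -> specnorm Q <= 1.
Proof.
by move=> QQ; apply: (@specnorm_gram_le1 _ _ 0 _ 0); rewrite mulmx0 addr0.
Qed.

Lemma specnorm_mxcol k (p : 'I_k -> nat) n (C : forall i, 'M[R]_(p i, n)) c :
  0 <= c -> (forall i, specnorm (C i) <= c) ->
  specnorm (\mxcol_i C i) <= Num.sqrt k%:R * c.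
Proof.
move=> c0 Cc; apply: specnorm_le => [|x]; first by rewrite mulr_ge0 ?sqrtr_ge0.
rewrite -ler_sqr ?nnegrE ?l2norm_ge0 ?mulr_ge0 ?sqrtr_ge0//.
rewrite l2norm_sqr mxcol_mul /dotv tr_mxcol mul_mxrow_mxcol summxE.
rewrite exprMn exprMn [X in X * _ * _]sqr_sqrtr ?ler0n// -mulrA -exprMn.
apply: (@le_trans _ _ (\sum_(i < k) (c * l2norm x) ^+ 2)); last first.
  by rewrite sumr_const card_ord mulr_natl.
apply: ler_sum => i _; rewrite -[leLHS]/(dotv _ _) -l2norm_sqr lerXn2r ?nnegrE ?l2norm_ge0//.
  by rewrite mulr_ge0// l2norm_ge0.
by rewrite (le_trans (l2norm_mulmx _ _))// ler_wpM2r// l2norm_ge0.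
Qed.

Lemma specnorm_mxrow k (p : 'I_k -> nat) n (C : forall i, 'M[R]_(n, p i)) c :
  0 <= c -> (forall i, specnorm (C i) <= c) ->
  specnorm (\mxrow_i C i) <= Num.sqrt k%:R * c.
Proof.
move=> c0 Cc; rewrite -specnorm_tr tr_mxrow specnorm_mxcol// => i.
by rewrite specnorm_tr.
Qed.

Lemma specnorm_mxblock k l (p : 'I_k -> nat) (q : 'I_l -> nat)
    (C : forall i j, 'M[R]_(p i, q j)) c :
  0 <= c -> (forall i j, specnorm (C i j) <= c) ->
  specnorm (\mxblock_(i, j) C i j) <= Num.sqrt k%:R * (Num.sqrt l%:R * c).
Proof.
move=> c0 Cc; rewrite mxblockEv specnorm_mxcol//; first by rewrite mulr_ge0 ?sqrtr_ge0.
by move=> i; apply: specnorm_mxrow.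
Qed.

End Norms.

(** * Normal forms for matrix identities *)

Section MatrixIdentities.
Variables (R : comPzRingType) (m n : nat).
Implicit Types A B : 'M[R]_(m, n).

Lemma mxDE A B i j : (A + B) i j = A i j + B i j.
Proof. by rewrite mxE. Qed.

Lemma mxNE A i j : (- A) i j = - A i j.
Proof. by rewrite mxE. Qed.

Lemma mx0E i j : (0 : 'M[R]_(m, n)) i j = 0.
Proof. by rewrite mxE. Qed.

Lemma trmxD A B : (A + B)^T = A^T + B^T.
Proof. exact: linearD. Qed.

Lemma trmxN A : (- A)^T = - A^T.
Proof. exact: linearN. Qed.

Lemma expmxS (X : 'M[R]_n) l : X ^+ l.+1 = X *m X ^+ l.
Proof. exact: exprS. Qed.

Lemma expmxSr (X : 'M[R]_n) l : X ^+ l.+1 = X ^+ l *m X.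
Proof. exact: exprSr. Qed.

End MatrixIdentities.

(** Brings an expression to a signed sum of left-associated products, the form that [mx_abel] can
    close. *)
Definition expand_mx :=
  (mulmxDl, mulmxDr, mulNmx, mulmxN, mulmxA, mul1mx, mulmx1).

Definition expand_tr := (trmxD, trmxN, trmx_mul, trmx1, @trmxK).

(* Decides identities that hold in the free abelian group on the products
   occurring in the goal. *)
Ltac mx_abel := apply/matrixP => ? ?; rewrite !(mxDE, mxNE, mx0E); ring.

(** * Symmetric absorption of a residual, and inverses of unipotent elements *)

Lemma symmetric_correction (R : realType) N m (Q D : 'M[R]_(N, m)) :
  Q^T *m Q = 1%:M -> D^T *m Q = Q^T *m D ->
  exists Delta : 'M[R]_N,
    [/\ Delta^T = Delta, Delta *m Q = - D & specnorm Delta <= 2 * specnorm D].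
Proof.
move=> QQ DQ; exists (- (D *m Q^T) - Q *m D^T + Q *m (D^T *m Q) *m Q^T); split.
- by rewrite !expand_tr -DQ mulmxA [_ - Q *m D^T]addrC.
- by rewrite !expand_mx -!mulmxA QQ !mulmx1; mx_abel.
(* Grouping two of the three terms exposes the projection [1 - Q Q^T], of norm at most 1, so the
   constant is 2 rather than 3. *)
- have -> : - (D *m Q^T) - Q *m D^T + Q *m (D^T *m Q) *m Q^T =
            - (D *m Q^T) - Q *m D^T *m (1%:M - Q *m Q^T).
    by rewrite !expand_mx; mx_abel.
  have Q1 := specnorm_isometry_le1 QQ.
  have P1 : specnorm (1%:M - Q *m Q^T) <= 1.
    apply: (@specnorm_gram_le1 _ _ _ _ _ Q^T); rewrite !expand_tr !expand_mx.
    by rewrite -(mulmxA Q _ Q) QQ mulmx1; mx_abel.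
  apply: le_trans (specnormB _ _) _; rewrite specnormN.
  have -> : 2 * specnorm D = specnorm D * 1 + 1 * specnorm D * 1 by ring.
  by rewrite lerD ?specnormM_le ?specnorm_tr.
Qed.

(** The inverse is the finite Neumann series in [- U]. It commutes with [U], so [1 - B = U B]
    inherits the nilpotency of [U] with the same exponent. *)
Lemma nilpotent_add1_inv (R : pzRingType) (U : R) k : U ^+ k = 0 ->
  exists B, [/\ (1 + U) * B = 1, B * (1 + U) = 1 & (1 - B) ^+ k = 0].
Proof.
move=> Uk; exists (\sum_(i < k) (- U) ^+ i).
set B := \sum_(i < k) _.
have UB : (1 + U) * B = 1.
  apply: oppr_inj; rewrite -mulNr opprD [- 1 - U]addrC -subrX1.
  by rewrite exprNn Uk mulr0 sub0r.
have cUB : GRing.comm U B.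
  by apply: commr_sum => i _; apply/commrX/commrN.
split=> //; first by rewrite mulrDr mulr1 -cUB -{1}[B]mul1r -mulrDl.
have -> : 1 - B = U * B by rewrite -{1}UB mulrDl mul1r addrC addKr.
by rewrite exprMn_comm// Uk mul0r.
Qed.

(** * Block triangular matrices and the Gram matrix of [V] *)

Section BlockMatrices.
Variables (R : realType) (k : nat) (r : 'I_k -> nat).
Implicit Types X Y : 'M[R]_(\sum_i r i).

Lemma submxblock_mulmx X Y i j :
  submxblock (X *m Y) i j = \sum_l submxblock X i l *m submxblock Y l j.
Proof.
by rewrite -{1}[X]submxblockK -{1}[Y]submxblockK mul_mxblock mxblockK.
Qed.

(* Block [(i, j)] vanishes whenever [j - i < d - c]; two shifts are used because
   subtraction on [nat] is truncated. *)
Definition block_upper (c d : nat) X :=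
  forall i j : 'I_k, (j + c < i + d)%N -> submxblock X i j = 0.

(** Shifts add up: in each term of block [(i, j)] of the product, the intermediate index [l] is too
    small for the first factor or too large for the second to be nonzero. *)
Lemma block_upperM c d c' d' X Y : block_upper c d X -> block_upper c' d' Y ->
  block_upper (c + c') (d + d') (X *m Y).
Proof.
move=> hX hY i j ij; rewrite submxblock_mulmx big1// => l _.
have [il|li] := ltnP (l + c) (i + d); first by rewrite hX ?mul0mx.
by rewrite hY ?mulmx0//; lia.
Qed.

Lemma block_upper_exp X l : block_upper 0 1 X -> block_upper 0 l (X ^+ l).
Proof.
move=> hX; elim: l => [|l IH] i j ij.
  rewrite expr0 -[1]/(1%:M) -mxdiagZ /mxdiag mxblockK ifF//.
  by apply/negbTE/eqP => ji; move: ij; rewrite ji; lia.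
by rewrite exprS; apply: (block_upperM hX IH); lia.
Qed.

Lemma block_upper_nilpotent X : block_upper 0 1 X -> X ^+ k = 0.
Proof.
move=> /(@block_upper_exp _ k) hX; apply/mxblockP => i j.
by rewrite hX ?submxblock0//; have := ltn_ord j; lia.
Qed.

Lemma mulmx_blkinj p (X : 'M[R]_(p, \sum_i r i)) i :
  X *m blkinj R r i = submxrow X i.
Proof. by rewrite mul_submxrow mulmx1. Qed.

Lemma tr_blkinj_mulmx p (X : 'M[R]_(\sum_i r i, p)) i :
  (blkinj R r i)^T *m X = submxcol X i.
Proof. by rewrite tr_submxrow trmx1 submxcol_mul mul1mx. Qed.

Lemma specnorm_blkinj i : specnorm (blkinj R r i) <= 1.
Proof.
apply: specnorm_isometry_le1; rewrite tr_blkinj_mulmx -submxblockEh.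
by rewrite -mxdiagZ submxblock_diag.
Qed.

Lemma specnorm_submxrow p (X : 'M[R]_(p, \sum_i r i)) i :
  specnorm (submxrow X i) <= specnorm X.
Proof.
by rewrite -mulmx_blkinj -[leRHS]mulr1 specnormM_le ?specnorm_blkinj.
Qed.

Lemma submxblock_mulmx_tr n (X Y : 'M[R]_(n, \sum_i r i)) i j :
  submxblock (X^T *m Y) i j = (submxrow X i)^T *m submxrow Y j.
Proof. by rewrite submxblockEh -mul_submxrow -submxcol_mul tr_submxrow. Qed.

Lemma block_upper_strict_upper_gram n (V : 'M[R]_(n, \sum_i r i)) :
  block_upper 0 1 (strict_upper_gram V).
Proof. by move=> i j ij; rewrite mxblockK ifF//; lia. Qed.

Lemma strict_upper_gramE n (V : 'M[R]_(n, \sum_i r i)) :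
  (forall i, (submxrow V i)^T *m submxrow V i = 1%:M) ->
  V^T *m V = 1%:M + strict_upper_gram V + (strict_upper_gram V)^T.
Proof.
move=> hV; apply/mxblockP => i j.
rewrite !submxblockD tr_mxblock !mxblockK submxblock_mulmx_tr.
have [<-|/eqP ij] := i =P j.
  by rewrite -mxdiagZ submxblock_diag ltnn hV trmx0 !addr0.
rewrite -mxdiagZ /mxdiag mxblockK (negbTE ij) add0r.
case: ltngtP => [ij'|ij'|/val_inj/eqP]; last by rewrite (negbTE ij).
- by rewrite trmx0 addr0.
- by rewrite add0r trmx_mul trmxK.
Qed.

End BlockMatrices.

(** * The blocks [X_l], [Y_l] and their residuals, without reference to the partition *)

Section AugmentedBasis.
Variables (R : realType) (n m s : nat).
Variables (A : 'M[R]_n) (T U B : 'M[R]_m) (V F : 'M[R]_(n, m)).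
Variables (W : 'M[R]_(n, s)) (K : 'M[R]_(s, m)).
Hypothesis VV : V^T *m V = 1%:M + U + U^T.
Hypothesis WW : W^T *m W = 1%:M.
Hypothesis UB : (1%:M + U) *m B = 1%:M.
Hypothesis BU : B *m (1%:M + U) = 1%:M.
Hypothesis KU : K *m U = 0.
Hypothesis AV : A *m V = V *m T + W *m K + F.

Let a := V^T *m W.
Let M := T *m U - U *m T - a *m K.
Let S : 'M[R]_m := 1%:M - B.

Definition aug_basis l : 'M[R]_(n, m) := V *m B *m S ^+ l.

Definition aug_next l : 'M[R]_(n, s) :=
  if l is l'.+1 then aug_basis l' *m B *m a else W - V *m B *m a.

Definition aug_resid l : 'M[R]_(n, m) :=
  A *m aug_basis l - aug_basis l *m T - aug_next l *m K.

Lemma aug_basisS l : aug_basis l.+1 = aug_basis l *m S.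
Proof. by rewrite /aug_basis expmxSr mulmxA. Qed.

Lemma aug_basis0 : aug_basis 0 = V *m B.
Proof. by rewrite /aug_basis expr0 mulmx1. Qed.

Lemma mulKB : K *m B = K.
Proof. by rewrite -[in RHS](mulmx1 K) -UB mulmxA mulmxDr KU mulmx1 addr0. Qed.

Lemma mulKS : K *m S = 0.
Proof. by rewrite mulmxBr mulmx1 mulKB subrr. Qed.

(** Write [V^T V = (1 + U) + (1 + U)^T - 1]; conjugating by [B] turns this into [B^T + B - B^T B],
    which is [1 - S^T S] for [S = 1 - B]. *)
Lemma gram_VB : (V *m B)^T *m (V *m B) = 1%:M - S^T *m S.
Proof.
have BtU : B^T *m (1%:M + U)^T = 1%:M by rewrite -trmx_mul UB trmx1.
rewrite trmx_mul -mulmxA (mulmxA V^T) VV.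
have -> : 1%:M + U + U^T = (1%:M + U) + (1%:M + U)^T - 1%:M.
  by rewrite trmxD trmx1; mx_abel.
rewrite mulmxBl mulmxDl UB mul1mx mulmxBr mulmxDr mulmx1 (mulmxA _ (_^T)) BtU.
by rewrite /S !expand_tr !expand_mx; mx_abel.
Qed.

Lemma gram_aug_basis l : (aug_basis l)^T *m aug_basis l =
  (S ^+ l)^T *m S ^+ l - (S ^+ l.+1)^T *m S ^+ l.+1.
Proof.
rewrite /aug_basis trmx_mul mulmxA -(mulmxA _ _ (V *m B)) gram_VB.
by rewrite expmxS trmx_mul !expand_mx.
Qed.

Lemma sum_gram_aug_basis k : \sum_(l < k) (aug_basis l)^T *m aug_basis l =
  1%:M - (S ^+ k)^T *m S ^+ k.
Proof.
elim: k => [|k IH]; first by rewrite big_ord0 expr0 trmx1 mulmx1 subrr.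
by rewrite big_ord_recr/= IH gram_aug_basis; mx_abel.
Qed.

(** Telescopes, because [X_(l+1)^T Y_(l+1) = S^T (X_l^T X_l) B a]. The remainder contains
    [S ^+ k.+1], so it vanishes when the number of summands reaches the nilpotency index. *)
Lemma sum_aug_basis_next k : \sum_(l < k.+1) (aug_basis l)^T *m aug_next l =
  - ((S ^+ k.+1)^T *m S ^+ k *m B *m a).
Proof.
elim: k => [|k IH]; rewrite big_ord_recr/= ?big_ord0 ?IH.
  rewrite aug_basis0 mulmxBr mulmxA gram_VB.
  rewrite trmx_mul -mulmxA -/a /S expr0 expr1 !expand_tr !expand_mx.
  by mx_abel.
rewrite aug_basisS trmx_mul -(mulmxA (aug_basis k)) -(mulmxA S^T).
rewrite (mulmxA (aug_basis k)^T) gram_aug_basis.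
by rewrite !expmxSr !expand_tr !expand_mx; mx_abel.
Qed.

(** Telescopes like the Gram matrices of the [X_l]. The remainder need not vanish, but being of the
    form [Z^T Z] it shows that the stack of the [Y_l] is a contraction. *)
Lemma sum_gram_aug_next k : \sum_(l < k.+1) (aug_next l)^T *m aug_next l =
  1%:M - (S ^+ k *m B *m a)^T *m (S ^+ k *m B *m a).
Proof.
elim: k => [|k IH]; rewrite big_ord_recr/= ?big_ord0 ?IH.
  have -> : (W - V *m B *m a)^T *m (W - V *m B *m a) =
      1%:M - a^T *m B *m a - a^T *m B^T *m a
      + a^T *m ((V *m B)^T *m (V *m B)) *m a.
    by rewrite -WW /a !expand_tr !expand_mx; mx_abel.
  by rewrite gram_VB expr0 mul1mx /S !expand_tr !expand_mx; mx_abel.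
have -> : (aug_basis k *m B *m a)^T *m (aug_basis k *m B *m a) =
    (B *m a)^T *m ((aug_basis k)^T *m aug_basis k) *m (B *m a).
  by rewrite !(trmx_mul, mulmxA).
by rewrite gram_aug_basis !expmxSr !expand_tr !expand_mx; mx_abel.
Qed.

(** [M + a K] is the commutator of [T] with [1 + U]; multiplying by the inverse [B] on both sides
    gives that of [T] with [B], up to sign. *)
Lemma commutator_TB : T *m B - B *m T = - (B *m (M + a *m K) *m B).
Proof.
have -> : M + a *m K = T *m (1%:M + U) - (1%:M + U) *m T.
  by rewrite /M !expand_mx; mx_abel.
by rewrite mulmxBr mulmxBl -!mulmxA UB !mulmxA BU mul1mx mulmx1 opprB.
Qed.

Lemma aug_resid0 : aug_resid 0 = F *m B - V *m B *m M *m B.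
Proof.
rewrite /aug_resid aug_basis0/= mulmxA AV.
have -> : (V *m T + W *m K + F) *m B - V *m B *m T - (W - V *m B *m a) *m K =
    V *m (T *m B - B *m T) + W *m (K *m B) + F *m B - W *m K + V *m B *m a *m K.
  by rewrite !expand_mx; mx_abel.
by rewrite commutator_TB mulKB !expand_mx -!(mulmxA _ K) mulKB; mx_abel.
Qed.

Lemma aug_residS l : aug_resid l.+1 = aug_resid l *m S + aug_basis l *m B *m M *m B.
Proof.
have -> : aug_resid l *m S = aug_resid l.+1 +
    aug_basis l *m (T *m B - B *m T) + aug_basis l *m B *m a *m K
    - aug_next l *m (K *m S).
  by rewrite /aug_resid aug_basisS/= /S !expand_mx; mx_abel.
rewrite mulKS mulmx0 commutator_TB !expand_mx -!(mulmxA _ K) mulKB.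
by mx_abel.
Qed.

Lemma specnorm_VB : specnorm (V *m B) <= 1.
Proof. by apply: (@specnorm_gram_le1 _ _ _ _ _ S); rewrite gram_VB subrK. Qed.

Lemma specnorm_S : specnorm S <= 1.
Proof.
by apply: (@specnorm_gram_le1 _ _ _ _ _ (V *m B)); rewrite gram_VB addrC subrK.
Qed.

Lemma specnorm_B : specnorm B <= 2.
Proof.
have -> : B = 1%:M - S by rewrite /S opprB addrC subrK.
have I1 : specnorm (1%:M : 'M[R]_m) <= 1.
  by apply: specnorm_isometry_le1; rewrite trmx1 mulmx1.
by apply: le_trans (specnormB _ _) _; have := specnorm_S; lra.
Qed.

Lemma specnorm_aug_basis l : specnorm (aug_basis l) <= 1.
Proof.
elim: l => [|l IH]; first by rewrite aug_basis0 specnorm_VB.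
by rewrite aug_basisS -[1]mulr1 specnormM_le// specnorm_S.
Qed.

(** Since [S] is a contraction, each step of the recursion adds at most the norm of [X_l B M B],
    that is [1 * 2 * mu * 2]. *)
Lemma specnorm_aug_resid mu l : specnorm M <= mu ->
  specnorm (aug_resid l) <= 2 * specnorm F + 2 * mu + 4 * l%:R * mu.
Proof.
move=> Mmu; elim: l => [|l IH].
  rewrite aug_resid0 mulr0 mul0r addr0 (le_trans (specnormB _ _))//.
  have -> : 2 * specnorm F + 2 * mu = specnorm F * 2 + 1 * mu * 2 by ring.
  by rewrite lerD ?specnormM_le ?specnorm_VB ?specnorm_B.
rewrite aug_residS (le_trans (specnormD _ _))//.
have -> : 2 * specnorm F + 2 * mu + 4 * l.+1%:R * mu =
    (2 * specnorm F + 2 * mu + 4 * l%:R * mu) * 1 + 1 * 2 * mu * 2.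
  by rewrite -natr1; ring.
by rewrite lerD ?specnormM_le ?specnorm_S ?specnorm_B ?specnorm_aug_basis.
Qed.

End AugmentedBasis.

(** * Block structure and norm of [M] *)

Lemma block_upper_last_row (R : realType) k (r : 'I_k.+1 -> nat)
    (X : 'M[R]_(\sum_i r i)) : block_upper 0 1 X -> submxcol X ord_max = 0.
Proof.
move=> hX; apply/mxrowP => j; rewrite -submxblockEv hX ?submxrow0//=.
by have := ltn_ord j; lia.
Qed.

Lemma block_upper_first_col (R : realType) k (r : 'I_k.+1 -> nat)
    (X : 'M[R]_(\sum_i r i)) : block_upper 0 1 X -> submxrow X ord0 = 0.
Proof.
by move=> hX; apply/mxcolP => i; rewrite -submxblockEh hX ?submxcol0//=; lia.
Qed.

Section CommutatorBound.
Variables (R : realType) (n k s : nat) (r : 'I_k.+1 -> nat).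
Variables (A : 'M[R]_n) (T U : 'M[R]_(\sum_i r i)) (V F : 'M[R]_(n, \sum_i r i)).
Variables (W : 'M[R]_(n, s)) (H : 'M[R]_(s, r ord_max)).
Let K := H *m (blkinj R r ord_max)^T.
Let M := T *m U - U *m T - V^T *m W *m K.
Hypothesis At : A^T = A.
Hypothesis Tt : T^T = T.
Hypothesis Ttri : block_tridiagonal T.
Hypothesis Uup : block_upper 0 1 U.
Hypothesis hV : forall i, (submxrow V i)^T *m submxrow V i = 1%:M.
Hypothesis VV : V^T *m V = 1%:M + U + U^T.
Hypothesis AV : A *m V = V *m T + W *m K + F.

(** [T] reaches one block below the diagonal and [U] starts one block above it, so neither product
    goes below; the term with [K] lives in the last block column. *)
Lemma block_upper_commutator : block_upper 0 0 M.
Proof.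
have Tup : block_upper 1 0 T by move=> i j ij; apply: Ttri; lia.
move=> i j ij; rewrite !submxblockB.
rewrite (block_upperM Tup Uup) ?(block_upperM Uup Tup); try lia.
rewrite subrr sub0r submxblockEh -mulmx_blkinj /K -!mulmxA tr_blkinj_mulmx.
rewrite -submxblockEh -mxdiagZ /mxdiag mxblockK ifF; last first.
  by apply/negbTE/eqP => /(congr1 val)/=; have := ltn_ord i; lia.
by rewrite !mulmx0 submxcol0 oppr0.
Qed.

(* Follows from the symmetry of [V^T A V]. *)
Lemma commutator_sub_tr : M - M^T = V^T *m F - F^T *m V.
Proof.
have : V^T *m (A *m V) = (V^T *m (A *m V))^T.
  by rewrite !trmx_mul trmxK At mulmxA.
rewrite AV trmx_mul trmxK !(trmxD, mulmxDl, mulmxDr).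
rewrite (mulmxA V^T V) trmx_mul -(mulmxA _ V^T V) VV => sym.
apply/eqP; rewrite -subr_eq0; move/esym/eqP: sym; rewrite -subr_eq0.
congr (_ == 0); rewrite /M !expand_tr Tt !expand_mx.
by mx_abel.
Qed.

Lemma specnorm_commutator_block i j :
  specnorm (submxblock M i j) <=
  Num.max (2 * specnorm F) (\big[Num.max/0]_i specnorm (submxblock M i i)).
Proof.
have V1 l : specnorm (submxrow V l) <= 1 by apply: specnorm_isometry_le1.
rewrite le_max; case: (ltngtP i j) => [ij|ji|/val_inj->].
- apply/orP; left.
  have -> : submxblock M i j = (submxrow V i)^T *m submxrow F j
      - (submxrow F i)^T *m submxrow V j.
    (* [M^T] is block lower triangular, so above the diagonal [M] agrees with [M - M^T]. *)
    have Mt0 : submxblock M^T i j = 0.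
      by rewrite -tr_submxblock block_upper_commutator ?trmx0//; lia.
    rewrite -!submxblock_mulmx_tr -submxblockB -commutator_sub_tr.
    by rewrite [RHS]submxblockB Mt0 subr0.
  apply: le_trans (specnormB _ _) _.
  have -> : 2 * specnorm F = 1 * specnorm F + specnorm F * 1 by ring.
  by rewrite lerD ?specnormM_le ?specnorm_tr ?specnorm_submxrow.
- rewrite block_upper_commutator; last by lia.
  by rewrite specnorm0 mulr_ge0 ?specnorm_ge0.
- by apply/orP; right; apply: le_bigmax.
Qed.

Lemma specnorm_commutator : specnorm M <=
  k.+1%:R * Num.max (2 * specnorm F)
                    (\big[Num.max/0]_i specnorm (submxblock M i i)).
Proof.
(* The factor [k.+1] is split into two square roots, one for the block rows and one for the block
   columns. *)
rewrite -{1}[M]submxblockK -[k.+1%:R]sqr_sqrtr ?ler0n// expr2 -mulrA.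
apply: specnorm_mxblock specnorm_commutator_block.
by rewrite le_max mulr_ge0 ?specnorm_ge0.
Qed.

End CommutatorBound.

(* MathComp world; the number of blocks k >= 1 is k'.+1, and the nk-dimensional
   space is indexed blockwise by \sum_(i < k'.+1) n. *)
Theorem theorem6 (R : realType) (n k' s : nat) (r : 'I_k'.+1 -> nat)
  (A : 'M[R]_n) (T : 'M[R]_(\sum_i r i))
  (V : 'M[R]_(n, \sum_i r i)) (W : 'M[R]_(n, s)) (H : 'M[R]_(s, r ord_max))
  (F : 'M[R]_(n, \sum_i r i))
  (hA : A^T = A)
  (hr : forall i, (0 < r i)%N)
  (hT : T^T = T)
  (hTtri : block_tridiagonal T)
  (hs : (s <= r ord_max)%N)
  (hV : forall i, (submxrow V i)^T *m submxrow V i = 1%:M)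
  (hW : W^T *m W = 1%:M)
  (hrec : A *m V = V *m T + W *m H *m (blkinj R r ord_max)^T + F) :
  let U := strict_upper_gram V in
  let a := V^T *m W in
  let M := T *m U - U *m T - a *m H *m (blkinj R r ord_max)^T in
  let k : R := k'.+1%:R in
  let e := specnorm F in
  let zeta := \big[Num.max/0]_(i < k'.+1) specnorm (submxblock M i i) in
  let mu := k * Num.max (2 * e) zeta in
  exists (Vh : 'M[R]_(\sum_(i < k'.+1) n, \sum_i r i))
         (Wh : 'M[R]_(\sum_(i < k'.+1) n, s))
         (Delta : 'M[R]_(\sum_(i < k'.+1) n)),
    [/\ Delta^T = Delta,
        [/\ Vh^T *m Vh = 1%:M, Vh^T *m Wh = 0 & specnorm Wh <= 1],
        (\mxdiag_(i < k'.+1) A + Delta) *m Vh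
          = Vh *m T + Wh *m H *m (blkinj R r ord_max)^T,
        Vh *m blkinj R r ord0
          = \mxcol_(i < k'.+1) (if i == ord0 then submxrow V ord0 else 0)
      & specnorm Delta
          <= 2 * (2 * Num.sqrt k * e
                  + 4 * Num.sqrt k * (Num.sqrt k + k - 1) * mu)].
Proof.
move=> U a M k e zeta mu.
set K := H *m (blkinj R r ord_max)^T.
have Uup : block_upper 0 1 U by apply: block_upper_strict_upper_gram.
have VV : V^T *m V = 1%:M + U + U^T by apply: strict_upper_gramE.
have [B [UB BU Sk]] := nilpotent_add1_inv (block_upper_nilpotent Uup).
(* [K] sees only the last block row of [U], which is zero by strict triangularity. *)
have KU : K *m U = 0.
  by rewrite -mulmxA tr_blkinj_mulmx block_upper_last_row ?mulmx0.
(* The first block column of [U] is zero, so [1 + U], and hence its inverse [B], fixes [E_1]. *)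
have BE : B *m blkinj R r ord0 = blkinj R r ord0.
  rewrite -[in RHS](mul1mx (blkinj _ _ _)) -[1%:M]BU -[_ * _]/(_ *m _) -mulmxA.
  by rewrite mulmxDl mul1mx mulmx_blkinj block_upper_first_col ?addr0.
have AV : A *m V = V *m T + W *m K + F by rewrite hrec /K !mulmxA.
have ME : M = T *m U - U *m T - V^T *m W *m K.
  by rewrite /M /a /K !mulmxA.
have Mmu : specnorm (T *m U - U *m T - V^T *m W *m K) <= mu.
  rewrite /mu /zeta ME; exact: (specnorm_commutator hA hT hTtri Uup hV VV AV).
clearbody mu.
pose X l : 'M_(n, \sum_i r i) := aug_basis B V l.
pose Y l : 'M_(n, s) := aug_next B V W l.
pose Vh : 'M_(\sum_(i < k'.+1) n, \sum_i r i) := \mxcol_(i < k'.+1) X i.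
pose Wh : 'M_(\sum_(i < k'.+1) n, s) := \mxcol_(i < k'.+1) Y i.
pose D : 'M_(\sum_(i < k'.+1) n, \sum_i r i) :=
  \mxcol_(i < k'.+1) aug_resid A T B V W K i.
have DE : D = \mxdiag_(i < k'.+1) A *m Vh - Vh *m T - Wh *m K.
  by rewrite mul_mxdiag_mxcol !mxcol_mul -!mxcolB.
have VhVh : Vh^T *m Vh = 1%:M.
  rewrite tr_mxcol mul_mxrow_mxcol (sum_gram_aug_basis VV UB).
  by rewrite Sk trmx0 mul0mx subr0.
have VhWh : Vh^T *m Wh = 0.
  rewrite tr_mxcol mul_mxrow_mxcol (sum_aug_basis_next W VV UB).
  by rewrite Sk trmx0 !mul0mx oppr0.
have Wh1 : specnorm Wh <= 1.
  (* The complement is the remainder [S^k' B a] of the telescoping sum. *)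
  apply: (@specnorm_gram_le1 _ _ _ _ _ ((1%:M - B) ^+ k' *m B *m a)).
  by rewrite tr_mxcol mul_mxrow_mxcol (sum_gram_aug_next VV hW UB) subrK.
(* Orthogonality of [Vh] and [Wh] removes the only term that is not visibly symmetric, so [Vh^T D]
   is symmetric as [symmetric_correction] requires. *)
have VhD : Vh^T *m D = Vh^T *m \mxdiag_(i < k'.+1) A *m Vh - T.
  by rewrite DE !mulmxBr !mulmxA VhVh mul1mx VhWh !mul0mx subr0.
have DVh : D^T *m Vh = Vh^T *m D.
  rewrite -{1}[Vh]trmxK -trmx_mul VhD trmxD trmxN !trmx_mul trmxK hT.
  by rewrite tr_mxdiag mulmxA; under eq_mxdiag => i do rewrite hA.
have [Delta [Dt DV Dn]] := symmetric_correction VhVh DVh.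
exists Vh, Wh, Delta; split=> //.
- rewrite mulmxDl DV DE -/K -mulmxA.
  by mx_abel.
- rewrite mxcol_mul; apply/eq_mxcolP => i; have [->|] := eqVneq i ord0.
    by rewrite /X aug_basis0 -mulmxA BE mulmx_blkinj.
  (* Every later block ends in the factor [S], and [S E_1 = E_1 - B E_1 = 0]. *)
  case: i => [[|i] hi]// _.
  by rewrite /X aug_basisS -mulmxA mulmxBl mul1mx BE subrr mulmx0.
- apply: le_trans Dn _; rewrite ler_pM2l//.
  have mu0 : 0 <= mu by apply: le_trans Mmu; apply: specnorm_ge0.
  have e0 : 0 <= e by apply: specnorm_ge0.
  have k1 : 1 <= k by rewrite ler1n.
  have sk1 : 1 <= Num.sqrt k by rewrite -{1}[1]sqrtr1 ler_wsqrtr.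
  have Dc : specnorm D <= Num.sqrt k * (2 * e + 2 * mu + 4 * k'%:R * mu).
    apply: specnorm_mxcol => [|i]; first by rewrite !addr_ge0 ?mulr_ge0.
    apply: le_trans (specnorm_aug_resid VV UB BU KU AV i Mmu) _.
    rewrite lerD2l ler_wpM2r// ler_wpM2l// ler_nat.
    by have := ltn_ord i; lia.
  apply: le_trans Dc _.
  rewrite (_ : k'%:R = k - 1); last by rewrite /k -natr1 addrK.
  have -> : 2 * Num.sqrt k * e + 4 * Num.sqrt k * (Num.sqrt k + k - 1) * mu
    = Num.sqrt k * (2 * e + 4 * (Num.sqrt k + k - 1) * mu) by ring.
  rewrite ler_wpM2l ?sqrtr_ge0// -addrA lerD2l.
  (* What remains is [2 mu + 4 (k - 1) mu <= 4 (sqrt k + k - 1) mu], true since [sqrt k >= 1] and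
     [mu >= 0]. *)
  nra.
Qed.
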